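(* Let $\lambda$ be a nonzero real number. For integers $n\ge 0$ let $(x)_{0,\lambda}=1$ and $(x)_{n,\lambda}=x(x-\lambda)\cdots(x-(n-1)\lambda)$ for $n\ge1$, and let $(x)_n=x(x-1)\cdots(x-n+1)$, $(x)_0=1$. Define the degenerate Stirling numbers of the second kind ${n \brace k}_{\lambda}$ by $(x)_{n,\lambda}=\sum_{k=0}^{n}{n \brace k}_{\lambda}(x)_{k}$ (with ${n\brace j}_\lambda=0$ for $j>n$). Define the degenerate Eulerian polynomials by $\sum_{j=0}^{\infty}(j+1)_{n,\lambda}x^{j}=\frac{A_{n,\lambda}(x)}{(1-x)^{n+1}}$ for $|x|<1$, and the degenerate Eulerian numbers by $A_{n,\lambda}(x)=\sum_{k=0}^{n}A_{\lambda}(n,k)x^{k}$, with $A_\lambda(n,k)=0$ for $k>n$. Then for all positive integers $n,k$, \[A_{\lambda}(n,k-1)=(-1)^{k}\sum_{j=0}^{k}(-1)^{j}\binom{n-j}{n-k}\,j!\,{n \brace j}_{\lambda}.\]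
   Context: Binomial coefficients $\binom{a}{b}$ with $b<0$ are taken to be $0$. *)

(* Defs.v *)
From HB Require Import structures.
From mathcomp Require Import all_boot all_order all_algebra.
From mathcomp Require Import all_classical all_reals all_analysis.
Set Implicit Arguments.
Unset Strict Implicit.
Unset Printing Implicit Defensive.
Import Order.TTheory GRing.Theory Num.Theory.
Import numFieldNormedType.Exports.
Local Open Scope classical_set_scope.
Local Open Scope ring_scope.

Definition falling (R : realType) (x : R) (n : nat) : R :=
  \prod_(i < n) (x - i%:R).

Definition degenerate_falling (R : realType) (lambda x : R) (n : nat) : R :=
  \prod_(i < n) (x - i%:R * lambda).

(* Both arguments are integers: truncated subtraction on nat would turn
   binom(n - j, n - k) into 1 instead of 0 when k > n. *)
Definition binomialz (R : realType) (a b : int) : R :=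
  match b with
  | Posz m => falling a%:~R m / m`!%:R
  | Negz _ => 0
  end.

(* Each of the defining relations below determines its object uniquely; a
   solution P of the second one satisfies deg (P n) <= n, so the third one is
   satisfiable. *)
Definition is_degenerate_stirling2 (R : realType) (lambda : R)
    (S : nat -> nat -> R) : Prop :=
  (forall (n : nat) (x : R),
     degenerate_falling lambda x n = \sum_(k < n.+1) S n k * falling x k) /\
  (forall n j : nat, (n < j)%N -> S n j = 0).

Definition is_degenerate_eulerian_poly (R : realType) (lambda : R)
    (P : nat -> {poly R}) : Prop :=
  forall (n : nat) (x : R), `|x| < 1 ->
    series (fun j : nat => degenerate_falling lambda j.+1%:R n * x ^+ j) @ \oo
      --> (P n).[x] / (1 - x) ^+ n.+1.

Definition is_degenerate_eulerian (R : realType) (P : nat -> {poly R})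
    (A : nat -> nat -> R) : Prop :=
  (forall n : nat, P n = \sum_(k < n.+1) A n k *: 'X^k) /\
  (forall n k : nat, (n < k)%N -> A n k = 0).

(* Main.v *)
Require Import Defs.
From HB Require Import structures.
From mathcomp Require Import all_boot all_order all_algebra.
From mathcomp Require Import all_classical all_reals all_analysis.
From mathcomp Require Import ring lra zify.
Import Order.TTheory GRing.Theory Num.Theory.
Import numFieldNormedType.Exports.
Local Open Scope classical_set_scope.
Local Open Scope ring_scope.

(** Let f(x) = (x)_{n,lambda}.  Expanding f in falling factorials and summing
    sum_j binom(j, i) x^j = x^i / (1 - x)^(i+1) gives
    (1 - x)^(n+1) sum_j f(j) x^j = B(x) := sum_i i! S(n,i) x^i (1 - x)^(n-i).
    Since f(0) = 0 for n > 0, the left-hand side is also x A_{n,lambda}(x), and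
    the formula is the comparison of the coefficients of x^k in x A = B. *)

Lemma falling_nat (R : realType) (m k : nat) :
  falling m%:R k = (m ^_ k)%:R :> R.
Proof.
rewrite /falling; elim: k => [|k IHk]; first by rewrite big_ord0 ffactn0.
rewrite big_ord_recr /= IHk ffactnSr natrM.
(* For [m < k] the truncated [m - k] differs from the real one, but the factor [m ^_ k] already
   vanishes. *)
have [le_km|lt_mk] := leqP k m; first by rewrite natrB.
by rewrite ffact_small // !mul0r.
Qed.

Lemma falling_bin (R : realType) (m k : nat) :
  falling m%:R k = k`!%:R * 'C(m, k)%:R :> R.
Proof. by rewrite falling_nat -bin_ffact natrM mulrC. Qed.

Lemma binomialz_nat (R : realType) (a b : nat) :
  binomialz R a%:Z b%:Z = 'C(a, b)%:R.
Proof.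
by rewrite /binomialz falling_bin mulrC mulKf // pnatr_eq0 -lt0n fact_gt0.
Qed.

Lemma degenerate_falling0 (R : realType) (lambda : R) (n : nat) :
  (0 < n)%N -> degenerate_falling lambda 0 n = 0.
Proof.
by case: n => // n _; rewrite /degenerate_falling big_ord_recl mul0r subr0 mul0r.
Qed.

(** Exponential decay beats polynomial growth: binom(N, k) e^k <= (1 + e)^N, so a small e > 0 gives
    a geometric majorant. *)
Lemma bin_mul_exp_cvg0 (R : realType) (k : nat) (x : R) :
  `|x| < 1 -> (fun N : nat => 'C(N, k)%:R * x ^+ N) @ \oo --> (0 : R).
Proof.
move=> x1; have x0 := normr_ge0 x.
have [e e0 r1] : exists2 e : R, 0 < e & `|(1 + e) * `|x| | < 1.
  (* With t = |x|, 1 - (1 + e) t = (1 - t)(2 - t) / 2 > 0. *)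
  exists ((1 - `|x|) / 2); first by lra.
  by rewrite ger0_norm; [nra | rewrite mulr_ge0 //; lra].
apply/norm_cvg0P.
apply: (@squeeze_cvgr _ _ _ _ (fun=> 0) (geometric (e ^- k) ((1 + e) * `|x|))).
- near=> N; rewrite normr_ge0 /= normrM normr_nat normrX exprMn mulrA.
  apply: ler_wpM2r; first exact: exprn_ge0.
  (* the k-th term of the binomial expansion of (1 + e) ^+ N *)
  rewrite mulrC ler_pdivlMr ?exprn_gt0 //.
  have [le_kN|lt_Nk] := leqP k N; last first.
    by rewrite bin_small // mul0r exprn_ge0 //; lra.
  rewrite exprDn (bigD1 (Ordinal (le_kN : (k < N.+1)%N))) //=.
  rewrite expr1n mul1r mulr_natl lerDl sumr_ge0 // => i _.
  by rewrite mulrn_wge0 // expr1n mul1r exprn_ge0 // ltW.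
- exact: cvg_cst.
- exact: cvg_geometric.
Unshelve. all: by end_near.
Qed.

(** Induction on k: the partial sums satisfy (1 - x) T_{k+1}(N) = x T_k(N) - binom(N, k+1) x^N,
    whose boundary term tends to 0 by [bin_mul_exp_cvg0]. *)
Lemma series_bin_cvg (R : realType) (k : nat) (x : R) : `|x| < 1 ->
  series (fun j : nat => 'C(j, k)%:R * x ^+ j) @ \oo
    --> x ^+ k / (1 - x) ^+ k.+1.
Proof.
move=> x1; have nx : 1 - x != 0.
  by rewrite subr_eq0; apply: contraTneq x1 => <-; rewrite normr1 ltxx.
elim: k => [|k IHk].
  rewrite expr0 expr1.
  under eq_fun do rewrite bin0.
  exact: cvg_geometric_series.
(* Pascal's rule, summed *)
have step N : series (fun j : nat => 'C(j, k.+1)%:R * x ^+ j) N =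
    (x * series (fun j : nat => 'C(j, k)%:R * x ^+ j) N
     - 'C(N, k.+1)%:R * x ^+ N) / (1 - x).
  apply: (mulIf nx); rewrite divfK //.
  elim: N => [|N IHN]; first by rewrite /series /= !big_geq // bin0n !mul0r mulr0 subr0.
  rewrite !seriesSr /= mulrDl IHN binS natrD exprS; ring.
have -> : x ^+ k.+1 / (1 - x) ^+ k.+2 =
    (x * (x ^+ k / (1 - x) ^+ k.+1) - 0) / (1 - x).
  by rewrite subr0 !exprS; field; rewrite nx expf_neq0.
rewrite (funext step); apply: cvgMr_tmp.
by apply: cvgB; [exact: cvgMl_tmp | exact: bin_mul_exp_cvg0].
Qed.

Lemma poly_eq_on_unit_ball (R : realType) (p q : {poly R}) :
  (forall x : R, `|x| < 1 -> p.[x] = q.[x]) -> p = q.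
Proof.
move=> pq; apply/eqP; rewrite -subr_eq0; apply/eqP.
set d := p - q.
(* The points 1/(i+2) lie strictly inside the unit ball; [size d] of them are more roots than a
   nonzero [d] can have. *)
have inj : injective (fun i : nat => (i.+2%:R : R)^-1).
  by move=> i j /invr_inj /eqP; rewrite eqr_nat => /eqP [].
apply: (@roots_geq_poly_eq0 _ d [seq (i.+2%:R)^-1 | i <- iota 0 (size d)]).
- apply/allP => _ /mapP[i _ ->]; rewrite /root /d hornerD hornerN pq ?subrr //.
  by rewrite ger0_norm ?invr_ge0 // invf_lt1 // ltr1n.
- by rewrite map_inj_uniq // iota_uniq.
- by rewrite size_map size_iota.
Qed.

(** The polynomial B of the overview, for arbitrary coefficients [c] in place of [S n]. *)
Definition eulerian_numerator {R : realType} (c : nat -> R) (n : nat) :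
    {poly R} :=
  \sum_(i < n.+1) (i`!%:R * c i) *: ('X^i * (1 - 'X) ^+ (n - i)).

Lemma series_falling_cvg (R : realType) (c : nat -> R) (n : nat) (x : R) :
  `|x| < 1 ->
  series (fun j : nat => (\sum_(i < n.+1) c i * falling j%:R i) * x ^+ j) @ \oo
    --> (eulerian_numerator c n).[x] / (1 - x) ^+ n.+1.
Proof.
move=> x1; have nx : 1 - x != 0.
  by rewrite subr_eq0; apply: contraTneq x1 => <-; rewrite normr1 ltxx.
have -> : (eulerian_numerator c n).[x] / (1 - x) ^+ n.+1 =
    \sum_(i < n.+1) (i`!%:R * c i) * (x ^+ i / (1 - x) ^+ i.+1).
  rewrite /eulerian_numerator horner_sum mulr_suml; apply: eq_bigr => i _.
  rewrite !(hornerZ, hornerM, horner_exp, hornerD, hornerN, hornerX, hornerC).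
  have le_in : (i <= n)%N by rewrite -ltnS.
  have -> : (1 - x) ^+ n.+1 = (1 - x) ^+ (n - i) * (1 - x) ^+ i.+1.
    by rewrite -exprD addnS subnK.
  by rewrite exprS; field; rewrite nx !expf_neq0.
have -> : series (fun j : nat =>
      (\sum_(i < n.+1) c i * falling j%:R i) * x ^+ j) =
    fun N => \sum_(i < n.+1) (i`!%:R * c i) *
      series (fun j : nat => 'C(j, i)%:R * x ^+ j) N.
  apply/funext => N; rewrite /series /=.
  under [RHS]eq_bigr do rewrite mulr_sumr.
  rewrite exchange_big /=; apply: eq_bigr => j _.
  rewrite mulr_suml; apply: eq_bigr => i _.
  by rewrite falling_bin; ring.
apply: cvg_big => [|i _]; first exact: add_continuous.
apply: cvgMl_tmp; exact: series_bin_cvg.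
Qed.

Lemma coef_1subX_exp (R : realType) (m i : nat) :
  ((1 - 'X : {poly R}) ^+ m)`_i = (-1) ^+ i * 'C(m, i)%:R.
Proof.
have -> : (1 - 'X : {poly R}) ^+ m =
    \poly_(i < m.+1) ((-1) ^+ i * 'C(m, i)%:R).
  rewrite exprDn poly_def; apply: eq_bigr => j _.
  by rewrite expr1n mul1r -scaleN1r exprZn -scaler_nat scalerA mulrC.
rewrite coef_poly ltnS; case: leqP => // lt_mi.
by rewrite bin_small // mulr0.
Qed.

(** For j <= k <= n, x^j (1 - x)^(n-j) contributes (-1)^(k-j) binom(n-j, k-j), and binom(n-j, k-j) =
    binom(n-j, n-k) by symmetry. *)
Lemma coef_eulerian_numerator (R : realType) (c : nat -> R) (n k : nat) :
  (eulerian_numerator c n)`_k =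
  (-1) ^+ k * \sum_(j < k.+1)
    (-1) ^+ j * binomialz R (n%:Z - j%:Z) (n%:Z - k%:Z) * j`!%:R * c j.
Proof.
rewrite /eulerian_numerator coef_sum.
under eq_bigr do rewrite coefZ coefXnM coef_1subX_exp.
have [lt_nk|le_kn] := ltnP n k.
  (* Both sides vanish: the lower index n - k is negative, and the numerator has degree at most
     n. *)
  rewrite !big1 ?mulr0 // => i _.
    have -> : n%:Z - k%:Z = Negz (k - n.+1) by lia.
    by rewrite /= mulr0 !mul0r.
  have := ltn_ord i; case: ifP => [|_ ?]; first by rewrite mulr0.
  by rewrite bin_small ?mulr0 //; lia.
rewrite mulr_sumr (big_ord_widen n.+1 (fun j => (-1) ^+ k *
  ((-1) ^+ j * binomialz R (n%:Z - j%:Z) (n%:Z - k%:Z) * j`!%:R * c j))) //.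
rewrite [RHS]big_mkcond; apply: eq_bigr => j _ /=.
rewrite ltnS; case: ltnP => [_|le_jk]; first by rewrite mulr0.
have -> : n%:Z - j%:Z = (n - j)%N by lia.
have -> : n%:Z - k%:Z = (n - k)%N by lia.
rewrite binomialz_nat -(@bin_sub (n - j) (k - j)); last by lia.
have -> : (n - j - (k - j) = n - k)%N by lia.
have -> : (-1) ^+ k = (-1) ^+ (k - j) * (-1) ^+ j :> R.
  by rewrite -exprD subnK.
have sgn : (-1) ^+ j * (-1) ^+ j = 1 :> R by rewrite -exprMn mulrNN mulr1 expr1n.
transitivity ((-1) ^+ (k - j) * ((-1) ^+ j * (-1) ^+ j) *
  'C(n - j, n - k)%:R * j`!%:R * c j); last by ring.
by rewrite sgn; ring.
Qed.

Theorem theorem2p11 (R : realType) (lambda : R) (S : nat -> nat -> R)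
    (P : nat -> {poly R}) (A : nat -> nat -> R) :
  lambda != 0 ->
  is_degenerate_stirling2 lambda S ->
  is_degenerate_eulerian_poly lambda P ->
  is_degenerate_eulerian P A ->
  forall n k : nat, (0 < n)%N -> (0 < k)%N ->
    A n k.-1 =
    (-1) ^+ k * \sum_(j < k.+1)
      (-1) ^+ j * binomialz R (n%:Z - j%:Z) (n%:Z - k%:Z) * j`!%:R * S n j.
Proof.
move=> _ [S_def _] P_def [PA A0] n k n_gt0 k_gt0.
have XP : 'X * P n = eulerian_numerator (S n) n.
  apply: poly_eq_on_unit_ball => x x1.
  have nx : 1 - x != 0.
    by rewrite subr_eq0; apply: contraTneq x1 => <-; rewrite normr1 ltxx.
  apply: (mulIf (invr_neq0 (expf_neq0 n.+1 nx))).
  rewrite hornerM hornerX -mulrA.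
  have limP := cvgMl_tmp (a := x) (P_def n x x1).
  (* Multiplication by x shifts the index by one; the new j = 0 term is zero since n > 0. *)
  have shift N : x * series (fun j : nat =>
        degenerate_falling lambda j.+1%:R n * x ^+ j) N =
      series (fun j : nat => (\sum_(i < n.+1) S n i * falling j%:R i) * x ^+ j)
        N.+1.
    rewrite /series /= big_nat_recl // -S_def degenerate_falling0 //.
    rewrite mul0r add0r mulr_sumr; apply: eq_bigr => j _.
    by rewrite -S_def exprS; ring.
  rewrite (funext shift) in limP.
  (* Both sides are limits of the same series, so uniqueness of limits identifies them. *)
  rewrite -(cvg_lim _ (limP _)) //.
  by apply: cvg_lim => //; rewrite cvg_shiftS; exact: series_falling_cvg.
have -> : A n k.-1 = (P n)`_k.-1.
  rewrite PA -(poly_def n.+1 (A n)) coef_poly ltnS.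
  by case: leqP => // /A0.
by rewrite -coef_eulerian_numerator -XP coefXM -[k == 0]negbK -lt0n k_gt0.
Qed.
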